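(* Let $F$ be an infinite field, let $S=F[x_1,\dots,x_n]$, let $I\subseteq S$ be a homogeneous ideal, let $>$ be a term order on the monomials of $S$, and let $\pi$ be a permutation of $\{1,\dots,n\}$, acting on $S$ by the $F$-algebra automorphism $\pi(x_i)=x_{\pi(i)}$. Let $>_\pi$ be the term order defined by $\pi(M_1)>_\pi\pi(M_2)$ if and only if $M_1>M_2$, for monomials $M_1,M_2$ of $S$. Then $$\operatorname{gin}_{>_\pi}(I)=\pi\bigl(\operatorname{gin}_{>}(I)\bigr).$$
   Context: For a term order $>$ and an ideal $I\subseteq S$, $\operatorname{In}_>(I)$ is the ideal generated by the initial monomials (largest monomials with respect to $>$) of the nonzero elements of $I$. A matrix $\alpha=(\alpha_{ij})\in GL_n(F)$ acts on $S$ by the $F$-algebra automorphism $x_j\mapsto \alpha_{1j}x_1+\cdots+\alpha_{nj}x_n$. For a homogeneous ideal $I$ there are a nonempty Zariski open set $U\subseteq GL_n(F)$ and a monomial ideal $J$ such that $\operatorname{In}_>(\alpha(I))=J$ for all $\alpha\in U$; this $J$ is the generic initial ideal $\operatorname{gin}_>(I)$. Term orders are not assumed to satisfy $x_1>\cdots>x_n$. *)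

(* Defs.v *)
From HB Require Import structures.
From mathcomp Require Import all_boot all_order all_algebra all_fingroup.
From mathcomp Require Import mpoly.

Set Implicit Arguments.
Unset Strict Implicit.
Unset Printing Implicit Defensive.

Import GRing.Theory.
Local Open Scope ring_scope.

Definition infinite_field (F : fieldType) : Prop :=
  forall s : seq F, exists x : F, x \notin s.

Section Ideals.
Variables (n : nat) (F : fieldType).
Local Notation S := {mpoly F[n]}.
Implicit Types (I J A : S -> Prop) (f p q : S).

(* Subsets of S are Prop-valued predicates, compared extensionally. *)
Definition same_set I J : Prop := forall p, I p <-> J p.

Definition is_ideal I : Prop :=
  [/\ I 0, forall p q, I p -> I q -> I (p + q) & forall f p, I p -> I (f * p)].

Definition homogeneous_ideal I : Prop :=
  is_ideal I /\ forall (d : nat) p, I p -> I (pihomog mdeg d p).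

Definition ideal_gen A : S -> Prop := fun p =>
  exists2 s : seq (S * S),
    forall u, u \in s -> A u.2 & p = \sum_(u <- s) u.1 * u.2.

Definition monomial_ideal J : Prop :=
  exists B : 'X_{1..n} -> Prop,
    same_set J (ideal_gen (fun q => exists2 m, B m & q = 'X_[m])).

Definition set_image (h : S -> S) I : S -> Prop := fun q =>
  exists2 p, I p & q = h p.

End Ideals.

Section Orders.
Variable n : nat.

(* [gt m1 m2] is the strict order "m1 > m2" on exponents.  The last two clauses
   make it a well-order (Dickson), so this is the usual notion of a term order;
   the variables may be ordered in any way. *)
Definition term_order (gt : rel 'X_{1..n}) : Prop :=
  [/\ irreflexive gt, transitive gt,
      forall m1 m2, m1 != m2 -> gt m1 m2 || gt m2 m1,
      forall m m1 m2, gt m1 m2 -> gt (m + m1)%MM (m + m2)%MM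
    & forall m, m != 0%MM -> gt m 0%MM].

(* The exponent of pi(x^m), where pi(x_i) = x_(pi i): see [msym_mnm_perm]. *)
Definition mnm_perm (pi : 'S_n) (m : 'X_{1..n}) : 'X_{1..n} :=
  [multinom m ((pi^-1)%g i) | i < n].

Lemma msym_mnm_perm (F : fieldType) (pi : 'S_n) (m : 'X_{1..n}) :
  msym pi ('X_[m] : {mpoly F[n]}) = 'X_[mnm_perm pi m].
Proof. exact: msymX. Qed.

Lemma msym_var (F : fieldType) (pi : 'S_n) (i : 'I_n) :
  msym pi ('X_i : {mpoly F[n]}) = 'X_(pi i).
Proof.
rewrite msymX; congr mpolyX; apply/mnmP=> j.
by rewrite mnmE !mnm1E -(inj_eq (@perm_inj _ pi)) permKV.
Qed.

End Orders.

Section GenericInitialIdeal.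
Variables (n : nat) (F : fieldType).
Local Notation S := {mpoly F[n]}.
Implicit Types (gt : rel 'X_{1..n}) (I J : S -> Prop).

Definition initial_exponent gt (f : S) (m : 'X_{1..n}) : Prop :=
  m \in msupp f /\ forall m', m' \in msupp f -> m' != m -> gt m m'.

Definition initial_ideal gt I : S -> Prop :=
  ideal_gen (fun q => exists f m,
    [/\ I f, f != 0, initial_exponent gt f m & q = 'X_[m]]).

(* x_j |-> alpha_{1j} x_1 + ... + alpha_{nj} x_n *)
Definition mx_act (alpha : 'M[F]_n) (p : S) : S :=
  p \mPo [tuple \sum_i alpha i j *: 'X_i | j < n].

(* GL_n(F) is the set [unitmx] in 'M[F]_n; the n * n polynomial variables stand
   for the matrix entries, through [mxvec]. *)
Definition zariski_open (U : 'M[F]_n -> Prop) : Prop :=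
  exists P : {mpoly F[n * n]} -> Prop, forall alpha,
    U alpha <-> alpha \in unitmx /\
                exists2 f, P f & f.@[fun k => mxvec alpha 0 k] != 0.

Definition is_gin gt I J : Prop :=
  monomial_ideal J /\
  exists U : 'M[F]_n -> Prop,
    [/\ zariski_open U, exists alpha, U alpha
      & forall alpha, U alpha ->
          same_set (initial_ideal gt (set_image (mx_act alpha) I)) J].

(* Definite description: the elements of the J such that [is_gin gt I J], which
   is unique over an infinite field, see [gin_is_gin]. *)
Definition gin gt I : S -> Prop := fun p => exists2 J, is_gin gt I J & J p.

Lemma zariski_openI U V : infinite_field F ->
  zariski_open U -> zariski_open V ->
  (exists alpha, U alpha) -> (exists alpha, V alpha) ->
  exists alpha, U alpha /\ V alpha.
Proof.
move=> Finf [P UP] [Q VQ] [a Ua] [b Vb].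
have [[ua [f Pf fa]] [_ [g Qg gb]]] := ((UP a).1 Ua, (VQ b).1 Vb).
pose L i j : {poly F} := (a i j)%:P + (b i j - a i j) *: 'X.
pose c t : 'M[F]_n := \matrix_(i, j) (L i j).[t].
pose h k := mxvec (\matrix_(i, j) L i j) 0 k.
have hE t k : (h k).[t] = mxvec (c t) 0 k.
  by rewrite /h; case/mxvec_indexP: k => i j; rewrite !mxvecE !mxE.
pose lift (e : {mpoly F[n * n]}) : {poly F} := mmap polyC h e.
have liftE e t : (lift e).[t] = e.@[fun k => mxvec (c t) 0 k].
  rewrite /lift mevalE /mmap horner_sum; apply: eq_bigr => m _.
  rewrite hornerM hornerC; congr (_ * _); rewrite /mmap1 horner_prod.
  by apply: eq_bigr => k _; rewrite horner_exp hE.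
pose D : {poly F} := \det (\matrix_(i, j) L i j).
have DE t : D.[t] = \det (c t).
  rewrite -[LHS]/(horner_eval t D) -det_map_mx; congr (\det _).
  by apply/matrixP=> i j; rewrite !mxE.
have c0 : c 0 = a.
  by apply/matrixP=> i j; rewrite mxE !hornerE.
have c1 : c 1 = b.
  by apply/matrixP=> i j; rewrite mxE /L hornerD hornerC hornerZ hornerX mulr1 subrKC.
have nz : D * lift f * lift g != 0.
  rewrite !mulf_neq0 //.
  - apply: contraTneq ua => D0; rewrite -c0 unitmxE -DE D0 horner0.
    by rewrite unitr0.
  - by apply: contraNneq fa => e0; rewrite -c0 -liftE e0 horner0.
  - by apply: contraNneq gb => e0; rewrite -c1 -liftE e0 horner0.
have [t nt] : exists t, ~~ root (D * lift f * lift g) t.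
  pose m := size (D * lift f * lift g).
  have [s us ss] : exists2 s : seq F, uniq s & size s = m.
    elim: m => [|m [s us <-]]; first by exists [::].
    by have [x xs] := Finf s; exists (x :: s); rewrite //= xs.
  have /allPn[t _ nt] : ~~ all (root (D * lift f * lift g)) s.
    by apply/negP=> /(max_poly_roots nz)/(_ us); rewrite ss ltnn.
  by exists t.
move: nt; rewrite !rootM !negb_or /root DE !liftE => /andP[/andP[Dt ft] gt].
have ut : c t \in unitmx by rewrite unitmxE unitfE.
by exists (c t); split; [apply/UP | apply/VQ]; split=> //; [exists f | exists g].
Qed.

Lemma gin_is_gin gt I J :
  infinite_field F -> is_gin gt I J -> same_set (gin gt I) J.
Proof.
move=> Finf gJ p; split=> [[K gK Kp]|]; last by exists J.
have [[_ [U [oU neU eU]]] [_ [V [oV neV eV]]]] := (gJ, gK).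
have [a [Ua Va]] := zariski_openI Finf oU oV neU neV.
exact/(eU a Ua)/(eV a Va).
Qed.

End GenericInitialIdeal.

(* Main.v *)
(* Permuting the variables of a linear change of coordinates amounts to
   permuting the rows of its matrix: pi o alpha = beta, where the rows of beta
   are those of alpha permuted by pi^-1.  Hence
   In_{>_pi}(beta(I)) = pi(In_>(alpha(I))), and since alpha |-> beta is a
   homeomorphism of GL_n(F) for the Zariski topology, pi carries a generic
   initial ideal for > to one for >_pi.  The converse is the same statement
   for pi^-1. *)
Require Import Defs.
From HB Require Import structures.
From mathcomp Require Import all_boot all_order all_algebra all_fingroup.
From mathcomp Require Import mpoly.

Set Implicit Arguments.
Unset Strict Implicit.
Unset Printing Implicit Defensive.

Import GRing.Theory.
Local Open Scope ring_scope.

Section PermuteVariables.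
Variables (n : nat) (F : fieldType).
Local Notation S := {mpoly F[n]}.
Implicit Types (I J A B : S -> Prop) (p q : S) (s : 'S_n).
Implicit Types (gt : rel 'X_{1..n}) (m : 'X_{1..n}).

Lemma mnm_permVK s : cancel (mnm_perm s^-1) (mnm_perm s).
Proof. by move=> m; apply/mnmP=> i; rewrite !mnmE invgK permKV. Qed.

Lemma mnm_permK s : cancel (mnm_perm s) (mnm_perm s^-1).
Proof. by move=> m; have := mnm_permVK s^-1 m; rewrite invgK. Qed.

Lemma msymVK s : cancel (@msym n F s^-1) (msym s).
Proof. by move=> p; rewrite -msymMm mulVg msym1m. Qed.

Lemma msymK s : cancel (@msym n F s) (msym s^-1).
Proof. by move=> p; rewrite -msymMm mulgV msym1m. Qed.

Lemma mem_msupp_msym s p m :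
  (m \in msupp (msym s p)) = (mnm_perm s^-1 m \in msupp p).
Proof.
rewrite !mcoeff_msupp mcoeff_sym; congr (p@_ _ != 0).
by apply/mnmP=> i; rewrite !mnmE invgK.
Qed.

(** [mnm_perm s] is an order isomorphism from [gt] to [gtpi] and maps the support of [p] bijectively
    onto that of [msym s p], so it matches their largest elements. *)
Lemma initial_exponent_msym gt gtpi s p m :
  (forall m1 m2, gtpi (mnm_perm s m1) (mnm_perm s m2) = gt m1 m2) ->
  initial_exponent gtpi (msym s p) (mnm_perm s m) <-> initial_exponent gt p m.
Proof.
move=> gtE; rewrite /initial_exponent mem_msupp_msym mnm_permK.
split=> -[pm max_m]; split=> // m' pm' ne.
  rewrite -gtE; apply: max_m; first by rewrite mem_msupp_msym mnm_permK.
  by rewrite (can_eq (mnm_permK s)).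
rewrite -(mnm_permVK s m') gtE; apply: max_m; first by rewrite -mem_msupp_msym.
by rewrite -(can_eq (mnm_permK s)) mnm_permVK.
Qed.

Lemma same_set_trans A B J : same_set A B -> same_set B J -> same_set A J.
Proof. by move=> AB BJ p; rewrite AB. Qed.

Lemma same_set_image h A B :
  same_set A B -> same_set (set_image h A) (set_image h B).
Proof. by move=> AB q; split=> -[p /AB]; exists p. Qed.

Lemma ideal_gen_sub A B p :
  (forall q, A q -> B q) -> ideal_gen A p -> ideal_gen B p.
Proof. by move=> AB [l Al ->]; exists l => // u /Al/AB. Qed.

Lemma same_ideal_gen A B :
  same_set A B -> same_set (ideal_gen A) (ideal_gen B).
Proof. by move=> AB p; split; apply: ideal_gen_sub => q /AB. Qed.

Lemma ideal_gen_msym s A :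
  same_set (ideal_gen (set_image (msym s) A))
           (set_image (msym s) (ideal_gen A)).
Proof.
(* One inclusion, for an arbitrary permutation [r]: taking [r] to be [s] and then [s^-1] yields both
   directions. *)
have img r B p : ideal_gen B p -> ideal_gen (set_image (msym r) B) (msym r p).
  move=> [l Bl ->]; exists [seq (msym r u.1, msym r u.2) | u <- l].
    by move=> _ /mapP[u lu ->]; exists u.2; first exact: Bl.
  by rewrite big_map raddf_sum; apply: eq_bigr => u _; rewrite /= msymM.
move=> q; split=> [Aq | [p Ap ->]]; last exact: img.
exists (msym s^-1 q); last by rewrite msymVK.
by apply: ideal_gen_sub (img _ _ _ Aq) => _ [_ [p Ap ->] ->]; rewrite msymK.
Qed.

Lemma initial_ideal_sub gt A B p :
  (forall q, A q -> B q) -> initial_ideal gt A p -> initial_ideal gt B p.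
Proof.
move=> AB; apply: ideal_gen_sub => q [f [m [/AB Bf nz fm ->]]].
by exists f, m.
Qed.

Lemma same_initial_ideal gt A B :
  same_set A B -> same_set (initial_ideal gt A) (initial_ideal gt B).
Proof. by move=> AB p; split; apply: initial_ideal_sub => q /AB. Qed.

(** It suffices to match generators: the initial monomial of [msym s f] for [gtpi] is the image of
    that of [f] for [gt]. *)
Lemma initial_ideal_msym gt gtpi s A :
  (forall m1 m2, gtpi (mnm_perm s m1) (mnm_perm s m2) = gt m1 m2) ->
  same_set (initial_ideal gtpi (set_image (msym s) A))
           (set_image (msym s) (initial_ideal gt A)).
Proof.
move=> gtE; apply: same_set_trans (ideal_gen_msym s _).
apply: same_ideal_gen => q; split.
  move=> [_ [m [[f Af ->] nz fm ->]]].
  exists 'X_[mnm_perm s^-1 m]; last by rewrite msym_mnm_perm mnm_permVK.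
  exists f, (mnm_perm s^-1 m); split=> //.
    by apply: contraNneq nz => ->; rewrite msym0.
  by apply/(initial_exponent_msym _ _ gtE); rewrite mnm_permVK.
move=> [_ [f [m [Af nz fm ->]]] ->].
exists (msym s f), (mnm_perm s m); split; first by exists f.
- by apply: contraNneq nz => f0; rewrite -(msymK s f) f0 msym0.
- exact/initial_exponent_msym.
- exact: msym_mnm_perm.
Qed.

Lemma monomial_ideal_msym s J :
  monomial_ideal J -> monomial_ideal (set_image (msym s) J).
Proof.
move=> [B JB]; exists (fun m => B (mnm_perm s^-1 m)).
apply: same_set_trans (same_set_image _ JB) _ => p.
rewrite -(ideal_gen_msym s _ p); apply: same_ideal_gen => q; split.
  move=> [_ [m Bm ->] ->]; exists (mnm_perm s m); first by rewrite mnm_permK.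
  exact: msym_mnm_perm.
move=> [m Bm ->]; exists 'X_[mnm_perm s^-1 m]; first by exists (mnm_perm s^-1 m).
by rewrite msym_mnm_perm mnm_permVK.
Qed.

(** Both sides are algebra morphisms in [p], so only the images of the variables matter: the left
    one sends x_j to the sum over i of a_{s(i),j} x_{s(i)}, which reindexing along [s] turns into
    the right one. *)
Lemma msym_mx_act s (a : 'M[F]_n) p :
  msym s (mx_act (row_perm s a) p) = mx_act a p.
Proof.
rewrite /mx_act !comp_mpolyE raddf_sum; apply: eq_bigr => m _.
rewrite /= msymZ rmorph_prod; congr (_ *: _); apply: eq_bigr => j _.
rewrite rmorphXn /= !tnth_mktuple raddf_sum [in RHS](reindex_inj (@perm_inj _ s)).
congr (_ ^+ _); apply: eq_bigr => i _.
by rewrite /= msymZ msym_var mxE.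
Qed.

Lemma zariski_open_mul (c : 'M[F]_n) (U : 'M[F]_n -> Prop) :
  c \in unitmx -> zariski_open U -> zariski_open (fun a => U (c *m a)).
Proof.
move=> uc [P UP].
(* The entries of [c *m a] as linear forms in those of [a]; substituting them pulls the defining
   polynomials of [U] back along left multiplication by [c]. *)
pose lq := [tuple \sum_l lin_mulmx c l k *: 'X_l | k < n * n] :
  (n * n).-tuple {mpoly F[n * n]}.
have lqE (f : {mpoly F[n * n]}) (a : 'M[F]_n) : (f \mPo lq).@[fun k => mxvec a 0 k] =
    f.@[fun k => mxvec (c *m a) 0 k].
  rewrite comp_mpoly_meval; apply: meval_eq => k.
  rewrite tnth_mktuple raddf_sum -(mul_vec_lin (mulmx c)) mxE.
  by apply: eq_bigr => l _; rewrite /= mevalZ mevalXU mulrC.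
exists (fun g => exists2 f, P f & g = f \mPo lq) => a.
rewrite UP unitmx_mul uc; split=> -[ua [f Pf fa]]; split=> //.
  by exists (f \mPo lq); [exists f | rewrite lqE].
by move: Pf fa => [g Pg ->]; rewrite lqE; exists g.
Qed.

Lemma is_gin_msym gt gtpi s I J :
  (forall m1 m2, gtpi (mnm_perm s m1) (mnm_perm s m2) = gt m1 m2) ->
  is_gin gt I J -> is_gin gtpi I (set_image (msym s) J).
Proof.
move=> gtE [Jmon [U [Uopen [a Ua] UJ]]].
split; first exact: monomial_ideal_msym.
(* For [b] in this set, [row_perm s b] lies in [U], and [msym_mx_act] writes b(I) as the image under
   [s] of (row_perm s b)(I), whose initial ideal for [gt] is [J]. *)
exists (fun b => U (perm_mx s *m b)); split.
- exact: zariski_open_mul (unitmx_perm _ s) Uopen.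
- exists (perm_mx s^-1 *m a).
  by rewrite mulmxA -perm_mxM mulgV perm_mx1 mul1mx.
move=> b; rewrite -row_permE => /UJ inJ.
apply: same_set_trans (same_set_image _ inJ).
apply: same_set_trans (initial_ideal_msym _ gtE).
apply: same_initial_ideal => q; split=> [[p Ip ->] | [_ [p Ip ->] ->]].
  by exists (mx_act (row_perm s b) p); [exists p | rewrite msym_mx_act].
by exists p => //; rewrite msym_mx_act.
Qed.

End PermuteVariables.

Theorem theorem2 (F : fieldType) (n : nat) (I : {mpoly F[n]} -> Prop)
  (gt gtpi : rel 'X_{1..n}) (pi : 'S_n)
  (Finf : infinite_field F)
  (Ihom : homogeneous_ideal I)
  (gt_order : term_order gt)
  (gtpi_def : forall M1 M2 : 'X_{1..n},
     gtpi (mnm_perm pi M1) (mnm_perm pi M2) = gt M1 M2) :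
  same_set (gin gtpi I) (set_image (msym pi) (gin gt I)).
Proof.
(* Each inclusion transports the ideal that witnesses membership in [gin], by [pi^-1] for the first
   and by [pi] for the second. *)
move=> q; split=> [[K gK Kq] | [p [J gJ Jp] ->]].
  exists (msym pi^-1 q); last by rewrite msymVK.
  exists (set_image (msym pi^-1) K); last by exists q.
  (* Transporting [gtpi] by [pi^-1] gives back [gt]. *)
  by apply: is_gin_msym gK => m1 m2; rewrite -gtpi_def !mnm_permVK.
exists (set_image (msym pi) J); last by exists p.
exact: is_gin_msym gJ.
Qed.
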